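(* Let $(\mathcal{S},\mathcal{A},p,\mu_0,\gamma)$ be a finite discounted Markov decision process setting (without reward), let $d$ be a metric on $\mathcal{S}\times\mathcal{A}$, and let $\mathcal{R}$ be the set of functions $r:\mathcal{S}\times\mathcal{A}\to\mathbb{R}$ that are Lipschitz with constant $1$ with respect to $d$. Let $\pi_E\in\Pi$ be an expert policy, with occupancy measure $\rho_E:=\rho_{\pi_E}$. Then the causal entropy regularized apprenticeship learning problem $$\operatorname*{arg\,min}_{\pi\in\Pi}\; -H(\pi)+\sup_{r\in\mathcal{R}}\Big(\mathbb{E}_{(s,a)\sim\rho_{E}}[r(s,a)]-\mathbb{E}_{(s,a)\sim\rho_{\pi}}[r(s,a)]\Big)$$ coincides with the problem $$\operatorname*{arg\,min}_{\pi\in\Pi}\; -H(\pi)+W_1^d(\rho_\pi,\rho_E),$$ in the sense that, for every $\pi\in\Pi$, $\sup_{r\in\mathcal{R}}\big(\mathbb{E}_{\rho_E}[r]-\mathbb{E}_{\rho_\pi}[r]\big)=W_1^d(\rho_\pi,\rho_E)$, so that the two objective functions of $\pi$ are equal.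
   Context: Setting: $\mathcal{S}$ and $\mathcal{A}$ are finite (nonempty) sets of states and actions; $p(\cdot\mid s,a)$ is a probability measure on $\mathcal{S}$ for every $(s,a)\in\mathcal{S}\times\mathcal{A}$; $\mu_0$ is a probability measure on $\mathcal{S}$ with $\mu_0(s)>0$ for all $s$; $\gamma\in(0,1)$. $\Pi$ is the set of stochastic policies, i.e. maps assigning to each $s\in\mathcal{S}$ a probability distribution $\pi(\cdot\mid s)$ on $\mathcal{A}$. Occupancy measure: for $\pi\in\Pi$, $\rho_\pi(s,a)=(1-\gamma)\,\pi(a\mid s)\sum_{t=0}^\infty\gamma^t\,\mathbb{P}[S_t=s]$, where $(S_t,A_t)_{t\ge 0}$ is the chain with $S_0\sim\mu_0$, $A_t\sim\pi(\cdot\mid S_t)$, $S_{t+1}\sim p(\cdot\mid S_t,A_t)$. It is a probability measure on $\mathcal{S}\times\mathcal{A}$. Causal entropy: $H(\pi)=\frac{1}{1-\gamma}\,\mathbb{E}_{(s,a)\sim\rho_\pi}[-\log\pi(a\mid s)]$ (with $0\log 0=0$). Wasserstein distance: for probability measures $\mu,\nu$ on $\mathcal{S}\times\mathcal{A}$, $W_1^d(\mu,\nu)=\min_{\kappa}\sum_{x,y}d(x,y)\,\kappa(x,y)$, the minimum being over all couplings $\kappa$ of $\mu$ and $\nu$, i.e. probability measures on $(\mathcal{S}\times\mathcal{A})^2$ with marginals $\mu$ and $\nu$. *)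

(* Defs.v *)
From mathcomp Require Import all_boot all_order all_algebra.
From mathcomp Require Import all_classical all_reals all_analysis.

Set Implicit Arguments.
Unset Strict Implicit.
Unset Printing Implicit Defensive.

Import Order.TTheory GRing.Theory Num.Theory.
Import numFieldNormedType.Exports.

Local Open Scope classical_set_scope.
Local Open Scope ring_scope.

Record fdist (R : realType) (T : finType) := FDist {
  pmf :> T -> R;
  pmf_ge0 : forall x, 0 <= pmf x;
  pmf_sum1 : \sum_x pmf x = 1
}.

Definition expectation_of (R : realType) (T : finType) (mu f : T -> R) : R :=
  \sum_x mu x * f x.

Definition argmin (R : realType) (T : Type) (f : T -> \bar R) : set T :=
  [set x | forall y, (f x <= f y)%E].

Definition policy (R : realType) (S A : finType) := S -> fdist R A.

(* Probability that (S_0, A_0, ..., A_(t-1), S_t) is (s_0, a_0, ..., s_t). *)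
Definition trajectory_prob (R : realType) (S A : finType)
    (p : S -> A -> fdist R S) (mu0 : fdist R S) (pi : policy R S A) (t : nat)
    (s : {ffun 'I_t.+1 -> S}) (a : {ffun 'I_t -> A}) : R :=
  mu0 (s ord0) *
  \prod_(i < t)
    (pi (s (widen_ord (leqnSn t) i)) (a i) *
     p (s (widen_ord (leqnSn t) i)) (a i) (s (lift ord0 i))).

(* P[S_t = x] *)
Definition state_prob (R : realType) (S A : finType)
    (p : S -> A -> fdist R S) (mu0 : fdist R S) (pi : policy R S A)
    (t : nat) (x : S) : R :=
  \sum_(s : {ffun 'I_t.+1 -> S} | s ord_max == x)
    \sum_(a : {ffun 'I_t -> A}) trajectory_prob p mu0 pi s a.

Definition occupancy (R : realType) (S A : finType)
    (p : S -> A -> fdist R S) (mu0 : fdist R S) (gamma : R)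
    (pi : policy R S A) (x : S * A) : R :=
  (1 - gamma) * pi x.1 x.2 *
  limn (series (fun t => gamma ^+ t * state_prob p mu0 pi t x.1)).

(* [ln 0 = 0] in the library; moreover [occupancy] vanishes wherever the policy
   does, so the convention 0 log 0 = 0 holds. *)
Definition causal_entropy (R : realType) (S A : finType)
    (p : S -> A -> fdist R S) (mu0 : fdist R S) (gamma : R)
    (pi : policy R S A) : R :=
  (1 - gamma)^-1 *
  expectation_of (occupancy p mu0 gamma pi) (fun x => - ln (pi x.1 x.2)).

Record is_metric (R : realType) (X : Type) (d : X -> X -> R) : Prop := IsMetric {
  metric_ge0 : forall x y, 0 <= d x y;
  metric_eq0 : forall x y, d x y = 0 <-> x = y;
  metric_sym : forall x y, d x y = d y x;
  metric_triangle : forall x y z, d x z <= d x y + d y z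
}.

(* The library's [lipschitz] notions use the canonical norm of a normed module;
   here the distance is an arbitrary [d]. *)
Definition lipschitz1 (R : realType) (X : Type) (d : X -> X -> R) :
    set (X -> R) :=
  [set r | forall x y, `|r x - r y| <= d x y].

Definition coupling (R : realType) (X : finType) (mu nu : X -> R) :
    set (fdist R (X * X)%type) :=
  [set kappa | (forall x, \sum_y kappa (x, y) = mu x) /\
               (forall y, \sum_x kappa (x, y) = nu y)].

Definition transport_cost (R : realType) (X : finType) (d : X -> X -> R)
    (kappa : fdist R (X * X)%type) : R :=
  \sum_x \sum_y d x y * kappa (x, y).

(* The infimum is taken in the extended reals, so that it is +oo, and not a
   junk real value, when there is no coupling. *)
Definition wasserstein1 (R : realType) (X : finType) (d : X -> X -> R)
    (mu nu : X -> R) : \bar R :=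
  ereal_inf [set (transport_cost d kappa)%:E | kappa in coupling mu nu].

(* sup over r in [F] of E_mu[r] - E_nu[r], in the extended reals. *)
Definition sup_expectation_gap (R : realType) (X : finType)
    (F : set (X -> R)) (mu nu : X -> R) : \bar R :=
  ereal_sup [set (expectation_of mu r - expectation_of nu r)%:E | r in F].

Definition apprenticeship_objective (R : realType) (S A : finType)
    (p : S -> A -> fdist R S) (mu0 : fdist R S) (gamma : R)
    (F : set (S * A -> R)) (piE pi : policy R S A) : \bar R :=
  ((- causal_entropy p mu0 gamma pi)%:E +
   sup_expectation_gap F (occupancy p mu0 gamma piE)
                         (occupancy p mu0 gamma pi))%E.

Definition wasserstein_objective (R : realType) (S A : finType)
    (p : S -> A -> fdist R S) (mu0 : fdist R S) (gamma : R)
    (d : S * A -> S * A -> R) (piE pi : policy R S A) : \bar R :=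
  ((- causal_entropy p mu0 gamma pi)%:E +
   wasserstein1 d (occupancy p mu0 gamma pi) (occupancy p mu0 gamma piE))%E.

(* Main.v *)
Require Import Defs.
From mathcomp Require Import all_boot all_order all_algebra.
From mathcomp Require Import all_classical all_reals all_analysis.

Set Implicit Arguments.
Unset Strict Implicit.
Unset Printing Implicit Defensive.

Import Order.TTheory GRing.Theory Num.Theory.
Import numFieldNormedType.Exports.

Local Open Scope classical_set_scope.
Local Open Scope ring_scope.

(* Occupancy measures are probability measures, so the equality of the two
   objectives is Kantorovich-Rubinstein duality on the finite metric space S * A.
   Let D be the supremum of the gaps. By Farkas' lemma, either some coupling has
   cost at most D, which by weak duality makes it optimal with cost D, or there
   are l >= 0, f and g with l d(x, y) + f(x) + g(y) >= 0 everywhere and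
   l D + E_mu[f] + E_nu[g] < 0. Integrating against the product measure excludes
   l = 0; if l > 0, a 1-Lipschitz function between -f / l and g / l has a gap
   larger than D. *)

(* Farkas' lemma by Bartl's induction on the number of rows: if [y] separates
   [b] from the last rows but not from the first row [a], scale it to [x] with
   [a *m x = -1] and apply the induction hypothesis to the projections
   [v + v *m x *m a] along [a] onto the annihilator of [x]. *)
Lemma farkas_mx (R : realFieldType) (m n : nat) (A : 'M[R]_(m, n))
    (b : 'rV[R]_n) :
  (exists2 k : 'rV[R]_m, forall i, 0 <= k 0 i & k *m A = b) \/
  (exists2 y : 'cV[R]_n, forall i, 0 <= (A *m y) i 0 & (b *m y) 0 0 < 0).
Proof.
elim: m A b => [|m IHm] A b.
  have [->|b_neq0] := eqVneq b 0.
    by left; exists 0 => [[]//|]; rewrite mul0mx.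
  right; exists (- b^T) => [[]//|]; rewrite mulmxN mxE oppr_lt0 mxE.
  have sq_ge0 j : 0 <= b 0 j * b^T j 0 by rewrite mxE -expr2 sqr_ge0.
  rewrite lt_neqAle sumr_ge0 // andbT eq_sym psumr_neq0 //=.
  have [j bj] : exists j, b 0 j != 0 by apply/rV0Pn.
  by apply/hasP; exists j; rewrite ?mem_index_enum// mxE -expr2 exprn_even_gt0.
rewrite -[m.+1]/(1 + m)%N in A *.
pose a := usubmx A; pose A0 := dsubmx A.
have AE : A = col_mx a A0 by rewrite vsubmxK.
have [[k k_ge0 kb]|[y Ay by_lt0]] := IHm A0 b.
  left; exists (row_mx 0 k); last by rewrite AE mul_row_col mul0mx add0r.
  by move=> i; rewrite mxE; case: fintype.split => j //; rewrite mxE.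
have [ay_ge0|ay_lt0] := leP 0 ((a *m y) 0 0).
  right; exists y => // i; rewrite AE mul_col_mx mxE.
  by case: fintype.split => j //; rewrite ord1.
pose x := (- (a *m y) 0 0)^-1 *: y.
have c_gt0 : 0 < (- (a *m y) 0 0)^-1 by rewrite invr_gt0 oppr_gt0.
have ax : a *m x = - 1%:M.
  rewrite [a *m x]mx11_scalar -scalemxAr mxE invrN mulNr mulVf ?lt_eqF//.
  by rewrite raddfN.
have bx_lt0 : (b *m x) 0 0 < 0 by rewrite -scalemxAr mxE pmulr_rlt0.
have A0x_ge0 i : 0 <= (A0 *m x) i 0 by rewrite -scalemxAr mxE mulr_ge0// ltW.
have [[k k_ge0 kb]|[z Az bz_lt0]] :=
    IHm (A0 + A0 *m x *m a) (b + b *m x *m a).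
  (* Solving the projected equation for [b] gives [a] the coefficient [k *m (A0 *m x) - b *m x],
     nonnegative because [A0 *m x >= 0] and [b *m x < 0]. *)
  left; exists (row_mx (k *m (A0 *m x) - b *m x) k).
    move=> i; rewrite mxE; case: fintype.split => j //.
    rewrite ord1 mxE [X in _ + X]mxE subr_ge0 (le_trans (ltW bx_lt0))// mxE sumr_ge0 // => l _.
    by rewrite mulr_ge0.
  rewrite AE mul_row_col mulmxBl -[RHS](addrK (b *m x *m a)) -kb mulmxDr.
  by rewrite !mulmxA [LHS]addrC addrA.
(* The correction along [x] makes [a] vanish; on [A0] and [b] it gives the values of their
   projections at [z]. *)
right; exists (z + x *m (a *m z)).
  move=> i; rewrite AE mul_col_mx mxE; case: fintype.split => j.
    by rewrite mulmxDr !mulmxA ax !mulNmx mul1mx subrr mxE.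
  by have := Az j; rewrite mulmxDl mulmxDr !mulmxA.
by move: bz_lt0; rewrite mulmxDl mulmxDr !mulmxA.
Qed.

(** Arbitrary finite index types allow unknowns and equations to be indexed by sum types below;
    [enum_val] and [enum_rank] carry the matrix version over. *)
Lemma farkas (R : realFieldType) (I J : finType) (a : I -> J -> R)
    (b : J -> R) :
  (exists2 k : I -> R, forall i, 0 <= k i &
     forall j, \sum_i k i * a i j = b j) \/
  (exists2 y : J -> R, forall i, 0 <= \sum_j a i j * y j &
     \sum_j b j * y j < 0).
Proof.
have [[k k_ge0 kb]|[y ay by_lt0]] := @farkas_mx R #|I| #|J|
  (\matrix_(i, j) a (enum_val i) (enum_val j)) (\row_j b (enum_val j)).
  left; exists (k 0 \o enum_rank) => [i|j] /=; first exact: k_ge0.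
  have /matrixP/(_ 0 (enum_rank j)) := kb.
  rewrite !mxE enum_rankK => <-.
  rewrite (reindex (@enum_val I I)); last exact: onW_bij (enum_val_bij I).
  by apply: eq_bigr => i _; rewrite mxE enum_valK enum_rankK.
right; exists (y^~ 0 \o enum_rank) => [i|].
  have := ay (enum_rank i); rewrite mxE => /le_trans; apply.
  rewrite [leRHS](reindex (@enum_val J J)); last exact: onW_bij (enum_val_bij J).
  by apply: ler_sum => j _; rewrite mxE /= enum_valK enum_rankK.
apply: le_lt_trans by_lt0; rewrite mxE.
rewrite [leLHS](reindex (@enum_val J J)); last exact: onW_bij (enum_val_bij J).
by apply: ler_sum => j _; rewrite mxE /= enum_valK.
Qed.

(** * Weak duality and Lipschitz interpolation *)

Lemma expectation_transport (R : realType) (X : finType) (mu nu r : X -> R)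
    (kappa : fdist R (X * X)%type) :
  coupling mu nu kappa ->
  expectation_of mu r - expectation_of nu r =
  \sum_x \sum_y (r x - r y) * kappa (x, y).
Proof.
move=> [kmu knu]; under [RHS]eq_bigr do under eq_bigr do rewrite mulrBl.
under [RHS]eq_bigr do rewrite sumrB.
rewrite sumrB; congr (_ - _); rewrite /expectation_of.
  by apply: eq_bigr => x _; rewrite -kmu mulrC mulr_sumr.
by rewrite exchange_big; apply: eq_bigr => y _; rewrite -knu mulrC mulr_sumr.
Qed.

Lemma expectation_gap_le_cost (R : realType) (X : finType) (d : X -> X -> R)
    (mu nu r : X -> R) (kappa : fdist R (X * X)%type) :
  coupling mu nu kappa -> lipschitz1 d r ->
  expectation_of mu r - expectation_of nu r <= transport_cost d kappa.
Proof.
move=> /expectation_transport -> rd.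
apply: ler_sum => x _; apply: ler_sum => y _.
by rewrite ler_wpM2r ?Defs.pmf_ge0// (le_trans (ler_norm _)) ?rd.
Qed.

(* The c-transform: [r y] is the maximum of [f x - d x y] over [x]. *)
Lemma lipschitz1_interpolation (R : realType) (X : finType) (d : X -> X -> R)
    (d_metric : is_metric d) (f g : X -> R) :
  (forall x y, f x - d x y <= g y) ->
  exists2 r, lipschitz1 d r & forall x, f x <= r x <= g x.
Proof.
move=> fg; have dxx x : d x x = 0 by apply/(Defs.metric_eq0 d_metric).
(* The default [f y] is the term at [x = y], as [d y y = 0], so it leaves the maximum unchanged. *)
pose r y := \big[Order.max/f y]_x (f x - d x y).
have f_le_g y : f y <= g y by have := fg y y; rewrite dxx subr0.
have le_r x y : f x - d x y <= r y by rewrite le_bigmax.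
have r_le y z : r y <= r z + d y z.
  apply/bigmax_leP; split=> [|x _].
    by rewrite -lerBlDr le_r.
  rewrite -lerBlDr (le_trans _ (le_r x z))// -addrA -opprD lerD2l lerN2.
  exact: Defs.metric_triangle.
exists r => [y z|y]; last by rewrite bigmax_ge_id; apply/bigmax_leP.
rewrite ler_norml lerBlDl r_le lerBrDr addrC lerBlDr.
by rewrite (Defs.metric_sym d_metric) r_le.
Qed.

Lemma expectation_le (R : realType) (X : finType) (mu : fdist R X)
    (f g : X -> R) :
  (forall x, f x <= g x) -> expectation_of mu f <= expectation_of mu g.
Proof. by move=> fg; apply: ler_sum => x _; rewrite ler_wpM2l ?Defs.pmf_ge0. Qed.

Lemma expectationDl (R : realType) (X : finType) (mu : fdist R X) (c : R)
    (f : X -> R) :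
  expectation_of mu (fun x => c + f x) = c + expectation_of mu f.
Proof.
rewrite /expectation_of; under eq_bigr do rewrite mulrDr.
by rewrite big_split -mulr_suml pmf_sum1 mul1r.
Qed.

Lemma expectationN (R : realType) (X : finType) (mu f : X -> R) :
  expectation_of mu (fun x => - f x) = - expectation_of mu f.
Proof. by rewrite /expectation_of -sumrN; apply: eq_bigr => x; rewrite mulrN. Qed.

(** * Strong duality *)

(** Taking any real upper bound [D] instead of the supremum keeps the linear system in [R]. *)
Lemma exists_coupling_cost_le (R : realType) (X : finType) (d : X -> X -> R)
    (d_metric : is_metric d) (mu nu : fdist R X) (D : R) :
  (forall r, lipschitz1 d r ->
     expectation_of mu r - expectation_of nu r <= D) ->
  exists2 kappa, coupling mu nu kappa & transport_cost d kappa <= D.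
Proof.
move=> le_D.
(* The unknowns are the masses [kappa (x, y)] and the slack
   [D - transport_cost d kappa]; the equations are the two marginal conditions
   and the definition of the slack. *)
pose a (i : 'I_1 + X * X) (j : 'I_1 + (X + X)) : R :=
  match i, j with
  | inl _, inl _ => 1
  | inl _, inr _ => 0
  | inr z, inl _ => d z.1 z.2
  | inr z, inr (inl x) => (z.1 == x)%:R
  | inr z, inr (inr y) => (z.2 == y)%:R
  end.
pose b (j : 'I_1 + (X + X)) : R :=
  match j with
  | inl _ => D
  | inr (inl x) => mu x
  | inr (inr y) => nu y
  end.
have sum_delta (F : X -> R) x : \sum_y (x == y)%:R * F y = F x.
  rewrite (bigD1 x)//= eqxx mul1r big1 ?addr0// => y.
  by rewrite eq_sym => /negPf ->; rewrite mul0r.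
have sum_pair (F : X * X -> R) : \sum_z F z = \sum_u \sum_v F (u, v).
  by rewrite pair_bigA; apply: eq_bigr => -[].
have [[k k_ge0 kb]|[y ay by_lt0]] := farkas a b.
  have k_mu x : \sum_y k (inr (x, y)) = mu x.
    have := kb (inr (inl x)); rewrite big_sumType /= big_ord1 mulr0 add0r => <-.
    rewrite sum_pair exchange_big /=; apply: eq_bigr => y _.
    rewrite -[LHS](sum_delta (fun u => k (inr (u, y)))).
    by apply: eq_bigr => u _; rewrite mulrC eq_sym.
  have k_nu y : \sum_x k (inr (x, y)) = nu y.
    have := kb (inr (inr y)); rewrite big_sumType /= big_ord1 mulr0 add0r => <-.
    rewrite sum_pair /=; apply: eq_bigr => x _.
    rewrite -[LHS](sum_delta (fun v => k (inr (x, v)))).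
    by apply: eq_bigr => v _; rewrite mulrC eq_sym.
  have k_sum1 : \sum_z k (inr z) = 1.
    rewrite -(pmf_sum1 mu) sum_pair.
    by apply: eq_bigr => x _; rewrite k_mu.
  exists (FDist (fun z => k_ge0 (inr z)) k_sum1); first by split.
  have := kb (inl ord0); rewrite big_sumType /= big_ord1 mulr1 => <-.
  rewrite -[leLHS]add0r lerD// /transport_cost /= pair_bigA.
  by apply: ler_sum => -[u v] _; rewrite mulrC.
(* The separating vector splits into a multiplier [l] for the cost equation and potentials [f], [g]
   for the two marginals. *)
pose l := y (inl ord0).
pose f x := y (inr (inl x)); pose g x := y (inr (inr x)).
have l_ge0 : 0 <= l.
  have := ay (inl ord0); rewrite big_sumType /= big_ord1 mul1r big1 ?addr0 //.
  by move=> j _; rewrite mul0r.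
have fg_ge0 u v : 0 <= d u v * l + (f u + g v).
  have := ay (inr (u, v)); rewrite big_sumType /= big_ord1.
  by rewrite big_sumType /= !sum_delta.
have fg_lt0 : D * l + (expectation_of mu f + expectation_of nu g) < 0.
  by have := by_lt0; rewrite big_sumType /= big_ord1 big_sumType.
have [l0|l_neq0] := eqVneq l 0.
  suff : 0 <= expectation_of mu f + expectation_of nu g.
    by rewrite leNgt; move: fg_lt0; rewrite l0 mulr0 add0r => ->.
  (* The sum is the iterated expectation of [f u + g v], which is nonnegative when [l = 0]. *)
  rewrite addrC -expectationDl; apply: sumr_ge0 => u _.
  rewrite mulr_ge0 ?Defs.pmf_ge0// addrC -expectationDl.
  apply: sumr_ge0 => v _; rewrite mulr_ge0 ?Defs.pmf_ge0//.
  by have := fg_ge0 u v; rewrite l0 mulr0 add0r.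
have l_gt0 : 0 < l by rewrite lt_def l_neq0.
have [u v|r rd fr] :=
    lipschitz1_interpolation d_metric
      (f := fun x => - f x / l) (g := fun x => g x / l).
  rewrite lerBlDr -(ler_pM2r l_gt0) mulrDl !divfK// -subr_ge0 opprK.
  by rewrite addrAC addrC (addrC (g v)).
(* As [- f / l <= r <= g / l], the gap of [r] is at least [- (E_mu[f] + E_nu[g]) / l], which exceeds
   [D] by [fg_lt0]. *)
have := le_D _ rd; rewrite leNgt => /negP; case.
apply: (@lt_le_trans _ _ (expectation_of mu (fun x => - f x / l) -
                          expectation_of nu (fun x => g x / l))); last first.
  by rewrite lerB// expectation_le// => x; have /andP[] := fr x.
have scale (m : fdist R X) (h : X -> R) :
    expectation_of m (fun x => h x / l) = expectation_of m h / l.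
  by rewrite /expectation_of mulr_suml; apply: eq_bigr => x _; rewrite mulrA.
rewrite (scale mu (fun x => - f x)) scale expectationN -mulrBl ltr_pdivlMr//.
by rewrite -subr_lt0 -opprD opprK.
Qed.

(** A single [kappa] serves both equalities, so the infimum is seen to be attained. *)
Lemma kantorovich_duality (R : realType) (X : finType) (d : X -> X -> R)
    (d_metric : is_metric d) (mu nu : fdist R X) :
  exists2 kappa, coupling mu nu kappa &
    sup_expectation_gap (lipschitz1 d) nu mu = (transport_cost d kappa)%:E /\
    wasserstein1 d mu nu = (transport_cost d kappa)%:E.
Proof.
(* The supremum is over [nu] minus [mu], while couplings bound [mu] minus [nu]; passing to [- r]
   exchanges the two. *)
have lipN r : lipschitz1 d r -> lipschitz1 d (fun x => - r x).
  by move=> rd x y; rewrite -opprD normrN; exact: rd.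
have gapN (m n : fdist R X) r : expectation_of m (fun x => - r x) -
    expectation_of n (fun x => - r x) = expectation_of n r - expectation_of m r.
  by rewrite !expectationN opprK addrC.
pose D := sup_expectation_gap (lipschitz1 d) nu mu.
have gap_le kappa : coupling mu nu kappa ->
    (D <= (transport_cost d kappa)%:E)%E.
  move=> k; apply: ge_ereal_sup => _ [r rd <-]; rewrite lee_fin -gapN.
  exact: expectation_gap_le_cost k (lipN _ rd).
have le_gap r : lipschitz1 d r ->
    ((expectation_of nu r - expectation_of mu r)%:E <= D)%E.
  by move=> rd; apply: ereal_sup_ubound; exists r.
(* The product coupling bounds [D] above and the zero function bounds it below, so [D] is finite. *)
have [k0 k0P] : exists k0, coupling mu nu k0.
  have prod_ge0 (z : X * X) : 0 <= mu z.1 * nu z.2.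
    by rewrite mulr_ge0 ?Defs.pmf_ge0.
  have prod_sum1 : \sum_z mu z.1 * nu z.2 = 1.
    rewrite -(pair_bigA _ (fun x y => mu x * nu y)) /= -(pmf_sum1 mu).
    by apply: eq_bigr => x _; rewrite -mulr_sumr pmf_sum1 mulr1.
  exists (FDist prod_ge0 prod_sum1); split => x /=.
    by rewrite -mulr_sumr pmf_sum1 mulr1.
  by rewrite -mulr_suml pmf_sum1 mul1r.
have lip0 : lipschitz1 d (fun=> 0).
  by move=> x y; rewrite subrr normr0 (Defs.metric_ge0 d_metric).
have D_fin : D \is a fin_num.
  rewrite fin_numElt (lt_le_trans (ltNyr _) (le_gap _ lip0))/=.
  by rewrite (le_lt_trans (gap_le _ k0P)) ?ltry.
have [r rd|kappa kP k_le] :=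
    @exists_coupling_cost_le _ _ _ d_metric mu nu (fine D).
  have := le_gap _ (lipN _ rd); rewrite -lee_fin fineK//.
  by rewrite gapN.
exists kappa => //.
have DE : D = (transport_cost d kappa)%:E.
  by apply/le_anti; rewrite gap_le//= -(fineK D_fin) lee_fin.
split=> //; apply/le_anti/andP; split.
  by apply: ereal_inf_lbound; exists kappa.
by apply: le_ereal_inf_tmp => _ [k kP' <-]; rewrite -DE gap_le.
Qed.

(** * Trajectory and state probabilities *)

Definition fcons (T : Type) (n : nat) (x : T) (f : {ffun 'I_n -> T}) :
    {ffun 'I_n.+1 -> T} :=
  [ffun i => oapp f x (unlift ord0 i)].

Lemma fcons0 (T : Type) (n : nat) (x : T) (f : {ffun 'I_n -> T}) :
  fcons x f ord0 = x.
Proof. by rewrite ffunE unlift_none. Qed.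

Lemma fconsS (T : Type) (n : nat) (x : T) (f : {ffun 'I_n -> T}) (i : 'I_n) :
  fcons x f (lift ord0 i) = f i.
Proof. by rewrite ffunE liftK. Qed.

Lemma sum_fcons (R : realType) (T : finType) (n : nat)
    (F : {ffun 'I_n.+1 -> T} -> R) :
  \sum_f F f = \sum_x \sum_(f : {ffun 'I_n -> T}) F (fcons x f).
Proof.
rewrite pair_bigA /= (reindex (fun z : T * {ffun 'I_n -> T} => fcons z.1 z.2)) //.
exists (fun f : {ffun 'I_n.+1 -> T} =>
    (f ord0, [ffun i : 'I_n => f (lift ord0 i)])) => [[x f] _|f _] /=.
  by rewrite fcons0; congr pair; apply/ffunP => i; rewrite ffunE fconsS.
apply/ffunP => i; case: (unliftP ord0 i) => [j|] ->.
  by rewrite fconsS ffunE.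
by rewrite fcons0.
Qed.

Lemma sum_ffun0 (R : realType) (T : finType) (F : {ffun 'I_0 -> T} -> R) :
  \sum_f F f = F (ffun0 (card_ord 0)).
Proof. by apply: big_pred1 => f; apply/esym/eqP/ffunP => -[]. Qed.

(** Markov property at the first step: after [x] and [a], the rest is a trajectory with initial law
    [p x a]. *)
Lemma trajectory_prob_fcons (R : realType) (S A : finType)
    (p : S -> A -> fdist R S) (mu0 : fdist R S) (pi : policy R S A) (t : nat)
    (x : S) (a : A) (s : {ffun 'I_t.+1 -> S}) (u : {ffun 'I_t -> A}) :
  trajectory_prob p mu0 pi (fcons x s) (fcons a u) =
  mu0 x * (pi x a * trajectory_prob p (p x a) pi s u).
Proof.
rewrite /trajectory_prob fcons0 big_ord_recl; congr (_ * _).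
rewrite (_ : widen_ord _ ord0 = ord0); last exact: val_inj.
rewrite !fcons0 fconsS -mulrA; congr (_ * (_ * _)).
apply: eq_bigr => i _.
rewrite (_ : widen_ord _ (lift ord0 i) = lift ord0 (widen_ord (leqnSn t) i));
  last exact: val_inj.
by rewrite !fconsS.
Qed.

(** The induction generalizes [mu0], since the tail of a trajectory starts from [p x a]. *)
Lemma sum_trajectory_prob (R : realType) (S A : finType)
    (p : S -> A -> fdist R S) (mu0 : fdist R S) (pi : policy R S A) (t : nat) :
  \sum_(s : {ffun 'I_t.+1 -> S}) \sum_(a : {ffun 'I_t -> A})
    trajectory_prob p mu0 pi s a = 1.
Proof.
elim: t mu0 => [|t IHt] mu0.
  rewrite sum_fcons -(pmf_sum1 mu0); apply: eq_bigr => x _.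
  by rewrite !sum_ffun0 /trajectory_prob big_ord0 fcons0 mulr1.
rewrite sum_fcons -(pmf_sum1 mu0); apply: eq_bigr => x _.
(* Summing over actions outermost exposes the first action [a], on which the law [p x a] of the tail
   depends. *)
rewrite exchange_big sum_fcons /=.
rewrite -[RHS]mulr1 -(pmf_sum1 (pi x)) mulr_sumr; apply: eq_bigr => a _.
rewrite exchange_big -[RHS]mulr1 -(IHt (p x a)) mulr_sumr; apply: eq_bigr => s _.
rewrite mulr_sumr; apply: eq_bigr => u _.
by rewrite trajectory_prob_fcons mulrA.
Qed.

Lemma trajectory_prob_ge0 (R : realType) (S A : finType)
    (p : S -> A -> fdist R S) (mu0 : fdist R S) (pi : policy R S A) (t : nat)
    (s : {ffun 'I_t.+1 -> S}) (a : {ffun 'I_t -> A}) :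
  0 <= trajectory_prob p mu0 pi s a.
Proof.
rewrite mulr_ge0 ?Defs.pmf_ge0// prodr_ge0// => i _.
by rewrite mulr_ge0 ?Defs.pmf_ge0.
Qed.

Lemma state_prob_ge0 (R : realType) (S A : finType)
    (p : S -> A -> fdist R S) (mu0 : fdist R S) (pi : policy R S A)
    (t : nat) (x : S) : 0 <= state_prob p mu0 pi t x.
Proof. by do 2!apply: sumr_ge0 => ? _; exact: trajectory_prob_ge0. Qed.

Lemma sum_state_prob (R : realType) (S A : finType)
    (p : S -> A -> fdist R S) (mu0 : fdist R S) (pi : policy R S A) (t : nat) :
  \sum_x state_prob p mu0 pi t x = 1.
Proof.
rewrite -(sum_trajectory_prob p mu0 pi t).
by rewrite [RHS](partition_big (fun s : {ffun 'I_t.+1 -> S} => s ord_max) predT).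
Qed.

(** * Occupancy measures as probability measures *)

(** Comparison with the geometric series, as state probabilities are at most 1. Convergence ensures
    that [limn] in [occupancy] is a genuine limit. *)
Lemma cvg_discounted_state_prob (R : realType) (S A : finType)
    (p : S -> A -> fdist R S) (mu0 : fdist R S) (gamma : R)
    (pi : policy R S A) (x : S) :
  0 < gamma -> gamma < 1 ->
  cvgn (series (fun t => gamma ^+ t * state_prob p mu0 pi t x)).
Proof.
move=> gamma_gt0 gamma_lt1.
apply: (@series_le_cvg _ _ (geometric 1 gamma)) => [t|t|t|].
- by rewrite mulr_ge0 ?exprn_ge0 ?state_prob_ge0 ?ltW.
- by rewrite /geometric /= mul1r exprn_ge0 ?ltW.
- rewrite /geometric /= mul1r; apply: ler_piMr; first by rewrite exprn_ge0 ?ltW.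
  rewrite -(sum_state_prob p mu0 pi t) (bigD1 x)//= lerDl sumr_ge0 // => y _.
  exact: state_prob_ge0.
- by apply: is_cvg_geometric_series; rewrite gtr0_norm.
Qed.

Lemma occupancy_ge0 (R : realType) (S A : finType)
    (p : S -> A -> fdist R S) (mu0 : fdist R S) (gamma : R)
    (pi : policy R S A) :
  0 < gamma -> gamma < 1 -> forall z, 0 <= occupancy p mu0 gamma pi z.
Proof.
move=> gamma_gt0 gamma_lt1 z.
apply: mulr_ge0; first by rewrite mulr_ge0 ?Defs.pmf_ge0 ?subr_ge0 ?ltW.
apply: limr_ge; first exact: cvg_discounted_state_prob.
near=> n; apply: sumr_ge0 => t _.
by rewrite mulr_ge0 ?exprn_ge0 ?state_prob_ge0 ?ltW.
Unshelve. all: by end_near. Qed.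

(** Summing out the actions and exchanging the finite sum over states with the limit leaves the
    geometric series, whose sum cancels [1 - gamma]. *)
Lemma sum_occupancy (R : realType) (S A : finType)
    (p : S -> A -> fdist R S) (mu0 : fdist R S) (gamma : R)
    (pi : policy R S A) :
  0 < gamma -> gamma < 1 -> \sum_z occupancy p mu0 gamma pi z = 1.
Proof.
move=> gamma_gt0 gamma_lt1.
pose discounted x t := gamma ^+ t * state_prob p mu0 pi t x.
rewrite -(pair_bigA _ (fun x a => (1 - gamma) * pi x a *
  limn (series (discounted x)))) /=.
under eq_bigr do rewrite -mulr_suml -mulr_sumr pmf_sum1 mulr1.
rewrite -mulr_sumr.
have -> : \sum_x limn (series (discounted x)) = 1 * (1 - gamma)^-1.
  have sum_cvg : (fun n => \sum_x series (discounted x) n) @ \oo -->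
      \sum_x limn (series (discounted x)).
    apply: cvg_big => [|x _]; first exact: add_continuous.
    exact: cvg_discounted_state_prob.
  rewrite -(cvg_lim _ sum_cvg)//; apply: cvg_lim => //.
  rewrite (_ : (fun n => _) = series (geometric 1 gamma)).
    by apply: cvg_geometric_series; rewrite gtr0_norm.
  apply/funext => n; rewrite /series /= exchange_big; apply: eq_bigr => t _.
  by rewrite -mulr_sumr sum_state_prob mulr1 mul1r.
by rewrite mul1r divff// subr_eq0 gt_eqF.
Qed.

(** * Equality of the two learning problems *)

Theorem proposition3p1 (R : realType) (S A : finType)
    (hS : (0 < #|S|)%N) (hA : (0 < #|A|)%N)
    (p : S -> A -> fdist R S)
    (mu0 : fdist R S) (mu0_gt0 : forall s, 0 < mu0 s)
    (gamma : R) (gamma_gt0 : 0 < gamma) (gamma_lt1 : gamma < 1)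
    (d : S * A -> S * A -> R) (d_metric : is_metric d)
    (piE : policy R S A) :
  [/\ (* the infimum defining the Wasserstein distance is a minimum *)
      forall pi : policy R S A,
        exists2 kappa,
          coupling (occupancy p mu0 gamma pi) (occupancy p mu0 gamma piE) kappa &
          wasserstein1 d (occupancy p mu0 gamma pi) (occupancy p mu0 gamma piE)
            = (transport_cost d kappa)%:E,
      forall pi : policy R S A,
        sup_expectation_gap (lipschitz1 d)
          (occupancy p mu0 gamma piE) (occupancy p mu0 gamma pi)
        = wasserstein1 d
          (occupancy p mu0 gamma pi) (occupancy p mu0 gamma piE),
      forall pi : policy R S A,
        apprenticeship_objective p mu0 gamma (lipschitz1 d) piE pi
        = wasserstein_objective p mu0 gamma d piE pi &
      argmin (apprenticeship_objective p mu0 gamma (lipschitz1 d) piE)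
        = argmin (wasserstein_objective p mu0 gamma d piE)].
Proof.
(* The coercion of [rho pi] to a function is [occupancy p mu0 gamma pi] by conversion, so duality
   applies to occupancies directly. *)
pose rho pi := FDist (occupancy_ge0 p mu0 pi gamma_gt0 gamma_lt1)
                    (sum_occupancy p mu0 pi gamma_gt0 gamma_lt1).
have duality pi := kantorovich_duality d_metric (rho pi) (rho piE).
have gapE pi : sup_expectation_gap (lipschitz1 d)
    (occupancy p mu0 gamma piE) (occupancy p mu0 gamma pi) =
    wasserstein1 d (occupancy p mu0 gamma pi) (occupancy p mu0 gamma piE).
  by have [kappa _ [gapE ->]] := duality pi.
have objE : apprenticeship_objective p mu0 gamma (lipschitz1 d) piE =
    wasserstein_objective p mu0 gamma d piE.
  by apply/funext => pi; rewrite /apprenticeship_objective gapE.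
split=> [pi|//|pi|]; rewrite ?objE//.
by have [kappa kP [_ W1E]] := duality pi; exists kappa.
Qed.
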